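(* Let $\Gamma=\langle\alpha_1,\dots,\alpha_e\rangle\subsetneq\mathbb{N}$, with minimal generators $\alpha_1<\dots<\alpha_e$, be a numerical semigroup that is either monomial or of the form $\langle\alpha_1,\alpha_2\rangle$ with $\gcd(\alpha_1,\alpha_2)=1$. Let $c$ be its conductor, and let $(C,O)$ be the unibranch complex curve singularity with $\widehat{\mathcal{O}_{C,O}}=\mathbb{C}[[t^{\alpha_1},\dots,t^{\alpha_e}]]$. Let $N$ be the minimal effective bound of $\Gamma$, i.e. the smallest integer $n^*$ such that the algorithm $\mathcal{A}$ described in the context, run with the truncated set $\Gamma_{\le n^*}=\Gamma\cap[0,n^*]$ in place of $\Gamma$, works correctly. Then $$N\le (c-1)(\alpha_1+2).$$
   Context: $\mathbb{N}=\{0,1,2,\dots\}$. A numerical semigroup is a submonoid $\Gamma\subseteq\mathbb{N}$ with finite complement. Its conductor $c$ is the least integer with $[c,\infty)\cap\mathbb{N}\subseteq\Gamma$. Monomial semigroups: $\Gamma$ is monomial if every reduced irreducible curve singularity with value semigroup $\Gamma$ has local ring isomorphic to $k[[t^{a_1},\dots,t^{a_m}]]$ for some $a_1,\dots,a_m$ with gcd $1$. By a result of Pfister and Steenbrink, $\Gamma$ is monomial if and only if it has one of the forms - $\{im\mid 0\le i\le s\}\cup[sm+b,\infty)$ with $1\le b<m$, $s\ge1$; - $\{0\}\cup[m,m+r-1]\cup[m+r+1,\infty)$ with $2\le r\le m-1$; - $\{0,m\}\cup[m+2,2m]\cup[2m+2,\infty)$ with $m\ge3$. Semimodules: a $\Gamma$-subsemimodule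 is a subset $\Delta\subseteq\Gamma$ with $\Delta+\Gamma\subseteq\Delta$. It has a unique minimal generating set $T_\Delta=\{\gamma_1,\dots,\gamma_m\}$, i.e. the smallest set with $\Delta=\bigcup_i(\gamma_i+\Gamma)$. Put $\mathscr{D}_\ell=\{\Delta\mid \Delta\text{ a }\Gamma\text{-subsemimodule},\ \#(\Gamma\setminus\Delta)=\ell\}$. For $\Delta\neq\Gamma$ put $\gamma_\Delta=\max(\Gamma\setminus\Delta)$ and $m(\Delta)=\Delta\cup\{\gamma_\Delta\}$, which is again a $\Gamma$-subsemimodule. Put $$\operatorname{Syz}(\Delta)=\{\sigma\in\Delta\mid \sigma=\gamma_i+b_1=\gamma_j+b_2\text{ for some }\gamma_i\ne\gamma_j\text{ in }T_\Delta,\ b_1,b_2\in\Gamma\},$$ and let $T_{\operatorname{Syz}(\Delta)}$ be its minimal generating set as a $\Gamma$-semimodule. Zeta function: let $A=\widehat{\mathcal{O}_{C,O}}$ and let $v$ be the $t$-adic valuation. $C^{[\Delta]}$ is the variety parametrizing ideals $I\subseteq A$ with $v(I\setminus\{0\})=\Delta$ (all of colength $\#(\Gamma\setminus\Delta)$). $K_0(\mathrm{Var}_{\mathbb{C}})$ is the Grothendieck ring of complex varieties and $\mathbb{L}$ is the class of the affine line. The truncated motivic Hilbert zeta function is $$Z^{\mathrm{Hilb},\le c}_{(C,O)}(q)=1+\sum_{\ell=1}^{c}\ \sum_{\Delta\in\mathscr{D}_\ell}[C^{[\Delta]}]\,q^\ell .$$ It is a known result, which may be used, that for $\Gamma$ as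 in the claim and every $\Gamma$-subsemimodule $\Delta\ne\Gamma$ with finite complement, $$[C^{[\Delta]}]=[C^{[m(\Delta)]}]\cdot\mathbb{L}^{C_1-C_2},\quad C_1=\#\{\gamma\in T_\Delta\mid\gamma<\gamma_\Delta\},\quad C_2=\#\{\sigma\in T_{\operatorname{Syz}(\Delta)}\mid\sigma<\gamma_\Delta\},\quad [C^{[\Gamma]}]=1,$$ so that the algorithm below, run with the full infinite $\Gamma$, returns $Z^{\mathrm{Hilb},\le c}_{(C,O)}(q)$. Algorithm $\mathcal{A}$ (input: $\Gamma$ and $c$; in the truncated version every $\Gamma$-subsemimodule $\Delta$ is replaced by a finite subset of $\Gamma_{\le n^*}$ representing $\Delta\cap[0,n^*]$, and only elements of $\Gamma_{\le n^*}$ are inspected). 1. (Tree) Start with $\mathscr{D}_1=\{\Gamma\setminus\{0\}\}$. For $\ell=1,\dots,c-1$, let $\mathscr{D}_{\ell+1}$ be the set of all $\Delta\setminus\{\gamma\}$ with $\Delta\in\mathscr{D}_\ell$ and $\gamma\in T_\Delta$. 2. For $\ell=1,\dots,c$ and each $\Delta\in\mathscr{D}_\ell$: compute $\gamma_\Delta$, $T_\Delta$, $\operatorname{Syz}(\Delta)$, $T_{\operatorname{Syz}(\Delta)}$, then $C_1=\#\{\gamma\in T_\Delta\mid\gamma<\gamma_\Delta\}$ and $C_2=\#\{\sigma\in T_{\operatorname{Syz}(\Delta)}\mid\sigma<\gamma_\Delta\}$, and set $[C^{[\Delta]}]=[C^{[m(\Delta)]}]\cdot\mathbb{L}^{C_1-C_2}$.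 3. Return $1+\sum_{\ell=1}^{c}\sum_{\Delta\in\mathscr{D}_\ell}[C^{[\Delta]}]q^\ell$. Subroutines: minimal generators of a semimodule $\{a_1<a_2<\dots\}$ are found by starting with $T=\{a_1\}$ and, for $i=2,3,\dots$, adding $a_i$ to $T$ exactly when $a_i-x\notin\Gamma$ for all $x\in T$. $\operatorname{Syz}(\Delta)$ is found by collecting the $a\in\Delta$ for which $a-\gamma\in\Gamma$ for at least two $\gamma\in T_\Delta$. ''Works correctly with $\Gamma_{\le n^*}$'' means that the output of the truncated version equals $Z^{\mathrm{Hilb},\le c}_{(C,O)}(q)$. *)

(* Defs.v *)
From HB Require Import structures.
From mathcomp Require Import all_boot all_order all_algebra.
From mathcomp Require Import generic_quotient.
From mathcomp Require Import boolp classical_sets functions cardinality fsbigop.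
From mathcomp Require Import reals complex.
From mathcomp.multinomials Require Import mpoly.
Set Implicit Arguments.
Unset Strict Implicit.
Unset Printing Implicit Defensive.
Import Order.TTheory GRing.Theory Num.Theory.
Local Open Scope classical_set_scope.
Local Open Scope ring_scope.
Local Open Scope quotient_scope.

(** * Numerical semigroups and semimodules *)

Definition numerical_semigroup (G : set nat) : Prop :=
  [/\ G 0%N, (forall a b, G a -> G b -> G (a + b)%N) & finite_set (~` G)].

(* Equal to 0 when no [c, oo) lies in A. *)
Definition conductor (A : set nat) : nat :=
  xget 0%N [set c | (forall n, (c <= n)%N -> A n) /\
    (forall c', (forall n, (c' <= n)%N -> A n) -> (c <= c')%N)].

Definition generated (s : seq nat) : set nat :=
  [set n | exists k : nat -> nat, n = (\sum_(a <- s) k a * a)%N].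

Definition minimal_generators (G : set nat) (s : seq nat) : Prop :=
  [/\ sorted ltn s, generated s = G &
      forall s', {subset s' <= s} -> generated s' = G -> {subset s <= s'}].

Definition semimodule (G D : set nat) : Prop :=
  forall d g, D d -> G g -> D (d + g)%N.

Definition subsemimodule (G D : set nat) : Prop :=
  D `<=` G /\ semimodule G D.

Definition semimodule_span (G T : set nat) : set nat :=
  [set d | exists t g, [/\ T t, G g & d = (t + g)%N]].

(* T_D, the smallest generating set, as the intersection of all of them. *)
Definition mingens (G D : set nat) : set nat :=
  [set g | forall T, semimodule_span G T = D -> T g].

Definition syz (G D : set nat) : set nat :=
  [set s | D s /\ exists g1 g2 b1 b2,
     [/\ mingens G D g1, mingens G D g2, g1 <> g2, G b1 & G b2] /\
     (s = g1 + b1)%N /\ (s = g2 + b2)%N].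

(* gamma_D = max (G \ D) *)
Definition maxgap (G D : set nat) : nat :=
  xget 0%N [set n | (G `\` D) n /\ forall k, (G `\` D) k -> (k <= n)%N].

(* m(D) *)
Definition fill (G D : set nat) : set nat := D `|` [set maxgap G D].

Definition count_below (T : set nat) (g : nat) : nat :=
  #|[pred i : 'I_g | (i : nat) \in T]|.

Definition C1 (G D : set nat) : nat := count_below (mingens G D) (maxgap G D).
Definition C2 (G D : set nat) : nat :=
  count_below (mingens G (syz G D)) (maxgap G D).

Definition semimodules_of_colength (G : set nat) (l : nat) : set (set nat) :=
  [set D | subsemimodule G D /\ (G `\` D #= `I_l)%card].

(** * Power series rings in one variable *)

Section Series.
Context (K : fieldType).

Definition series := nat -> K.

Definition sadd (f g : series) : series := fun n => f n + g n.
Definition sscale (a : K) (f : series) : series := fun n => a * f n.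
Definition smul (f g : series) : series :=
  fun n => \sum_(i < n.+1) f i * g (n - i)%N.
Definition sone : series := fun n => (n == 0%N)%:R.

Definition has_valuation (f : series) (n : nat) : Prop :=
  f n <> 0 /\ forall m, (m < n)%N -> f m = 0.

(* v(I \ {0}) *)
Definition values (I : set series) : set nat :=
  [set n | exists2 f, I f & has_valuation f n].

(* For G generated by a_1, ..., a_m this is K[[t^a_1, ..., t^a_m]]. *)
Definition semigroup_ring (G : set nat) : set series :=
  [set f | forall n, f n <> 0 -> G n].

(* The complete local rings of reduced irreducible curve singularities, as
   subalgebras of their normalization K[[t]]: those containing a nonzero
   ideal of K[[t]]. *)
Definition branch (O : set series) : Prop :=
  [/\ O sone, (forall f g, O f -> O g -> O (sadd f g)),
      (forall f g, O f -> O g -> O (smul f g)),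
      (forall a f, O f -> O (sscale a f)) &
      exists N, forall f, (forall n, (n < N)%N -> f n = 0) -> O f].

Definition alg_isomorphic (O O' : set series) : Prop :=
  exists phi : series -> series,
    [/\ set_bij O O' phi,
        (forall f g, O f -> O g -> phi (sadd f g) = sadd (phi f) (phi g)),
        (forall f g, O f -> O g -> phi (smul f g) = smul (phi f) (phi g)) &
        (forall a f, O f -> phi (sscale a f) = sscale a (phi f))].

Definition monomial_semigroup (G : set nat) : Prop :=
  forall O, branch O -> values O = G ->
  exists s : seq nat, (\big[gcdn/0]_(a <- s) a = 1)%N /\
    alg_isomorphic O (semigroup_ring (generated s)).

Definition ideal (A I : set series) : Prop :=
  [/\ I `<=` A, I (fun=> 0), (forall f g, I f -> I g -> I (sadd f g)) &
      forall a f, A a -> I f -> I (smul a f)].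

End Series.

(** * The Grothendieck ring of complex varieties *)

(* Every complex variety is a finite disjoint union of locally closed pieces
   that are locally closed in some affine space, so K_0(Var_C) is presented by
   the isomorphism classes of the latter, with the scissor and product
   relations. *)

Section Varieties.
Context (R : realType).
Local Notation C := R[i].

Definition zeros n (S : seq {mpoly C[n]}) : set 'rV[C]_n :=
  [set x | forall p, p \in S -> meval (fun i => x 0 i) p = 0].

Definition locally_closed n (X : set 'rV[C]_n) : Prop :=
  exists S T, X = zeros S `\` zeros T.

Definition regular_fun n (X : set 'rV[C]_n) (f : 'rV[C]_n -> C) : Prop :=
  forall x, X x -> exists p q : {mpoly C[n]},
    meval (fun i => x 0 i) q <> 0 /\
    forall y, X y -> meval (fun i => y 0 i) q <> 0 ->
      f y = meval (fun i => y 0 i) p / meval (fun i => y 0 i) q.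

Definition regular_map n m (X : set 'rV[C]_n) (Y : set 'rV[C]_m)
    (f : 'rV[C]_n -> 'rV[C]_m) : Prop :=
  (forall x, X x -> Y (f x)) /\ forall j, regular_fun X (fun x => f x 0 j).

Definition isomorphic n m (X : set 'rV[C]_n) (Y : set 'rV[C]_m) : Prop :=
  exists f g, [/\ regular_map X Y f, regular_map Y X g,
    (forall x, X x -> g (f x) = x) & (forall y, Y y -> f (g y) = y)].

Definition product n m (X : set 'rV[C]_n) (Y : set 'rV[C]_m) :
    set 'rV[C]_(n + m) :=
  [set z | X (lsubmx z) /\ Y (rsubmx z)].

Record variety := Variety {
  vdim : nat;
  vset : set 'rV[C]_vdim;
  _ : locally_closed vset }.
Arguments vset : clear implicits.

(* Formal ring expressions in varieties, and the congruence generated by the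
   axioms of commutative rings and the relations of K_0(Var_C). *)
Inductive K0expr : Type :=
| KClass of variety
| KZero | KOne
| KAdd of K0expr & K0expr
| KOpp of K0expr
| KMul of K0expr & K0expr.

Inductive K0eqv : K0expr -> K0expr -> Prop :=
| eqv_refl x : K0eqv x x
| eqv_sym x y : K0eqv x y -> K0eqv y x
| eqv_trans x y z : K0eqv x y -> K0eqv y z -> K0eqv x z
| eqv_add x x' y y' :
    K0eqv x x' -> K0eqv y y' -> K0eqv (KAdd x y) (KAdd x' y')
| eqv_opp x x' : K0eqv x x' -> K0eqv (KOpp x) (KOpp x')
| eqv_mul x x' y y' :
    K0eqv x x' -> K0eqv y y' -> K0eqv (KMul x y) (KMul x' y')
| eqv_addA x y z : K0eqv (KAdd x (KAdd y z)) (KAdd (KAdd x y) z)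
| eqv_addC x y : K0eqv (KAdd x y) (KAdd y x)
| eqv_add0 x : K0eqv (KAdd KZero x) x
| eqv_addN x : K0eqv (KAdd (KOpp x) x) KZero
| eqv_mulA x y z : K0eqv (KMul x (KMul y z)) (KMul (KMul x y) z)
| eqv_mulC x y : K0eqv (KMul x y) (KMul y x)
| eqv_mul1 x : K0eqv (KMul KOne x) x
| eqv_mulD x y z :
    K0eqv (KMul (KAdd x y) z) (KAdd (KMul x z) (KMul y z))
| eqv_iso X Y :
    isomorphic (vset X) (vset Y) -> K0eqv (KClass X) (KClass Y)
| eqv_scissor n (X Z U : set 'rV[C]_n) (hX : locally_closed X)
    (hZ : locally_closed Z) (hU : locally_closed U) S :
    Z = X `&` zeros S -> U = X `\` zeros S ->
    K0eqv (KClass (Variety hX))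
          (KAdd (KClass (Variety hZ)) (KClass (Variety hU)))
| eqv_prod n m (X : set 'rV[C]_n) (Y : set 'rV[C]_m) (hX : locally_closed X)
    (hY : locally_closed Y) (hXY : locally_closed (product X Y)) :
    K0eqv (KClass (Variety hXY))
          (KMul (KClass (Variety hX)) (KClass (Variety hY)))
| eqv_point (h : locally_closed [set: 'rV[C]_0]) :
    K0eqv (KClass (Variety h)) KOne.

HB.instance Definition _ := gen_eqMixin K0expr.
HB.instance Definition _ := gen_choiceMixin K0expr.

Definition K0rel (x y : K0expr) : bool := `[< K0eqv x y >].

Lemma K0rel_refl : reflexive K0rel.
Proof. by move=> x; apply/asboolP; exact: eqv_refl. Qed.

Lemma K0rel_sym : ssrbool.symmetric K0rel.
Proof. by move=> x y; apply/asboolP/asboolP; exact: eqv_sym. Qed.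

Lemma K0rel_trans : transitive K0rel.
Proof.
by move=> y x z /asboolP xy /asboolP yz; apply/asboolP; exact: eqv_trans xy yz.
Qed.

Canonical K0_equiv := EquivRel K0rel K0rel_refl K0rel_sym K0rel_trans.

Definition K0 := {eq_quot K0rel}.
HB.instance Definition _ := Choice.on K0.

Definition K0of (x : K0expr) : K0 := \pi_K0 x.

Lemma K0ofP x y : K0eqv x y <-> K0of x = K0of y.
Proof.
split=> [xy|/eqmodP/asboolP//]; apply/eqmodP; exact/asboolP.
Qed.

Lemma K0of_repr (x : K0) : K0of (repr x) = x.
Proof. exact: reprK. Qed.

Lemma repr_K0of x : K0eqv (repr (K0of x)) x.
Proof. by apply/K0ofP; rewrite K0of_repr. Qed.

Definition K0add (x y : K0) : K0 := K0of (KAdd (repr x) (repr y)).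
Definition K0opp (x : K0) : K0 := K0of (KOpp (repr x)).
Definition K0mul (x y : K0) : K0 := K0of (KMul (repr x) (repr y)).

Lemma K0of_add x y : K0add (K0of x) (K0of y) = K0of (KAdd x y).
Proof. by apply/K0ofP; apply: eqv_add; exact: repr_K0of. Qed.

Lemma K0of_opp x : K0opp (K0of x) = K0of (KOpp x).
Proof. by apply/K0ofP; apply: eqv_opp; exact: repr_K0of. Qed.

Lemma K0of_mul x y : K0mul (K0of x) (K0of y) = K0of (KMul x y).
Proof. by apply/K0ofP; apply: eqv_mul; exact: repr_K0of. Qed.

Lemma K0addA : associative K0add.
Proof.
move=> x y z; rewrite -(K0of_repr x) -(K0of_repr y) -(K0of_repr z).
by rewrite !K0of_add; apply/K0ofP; exact: eqv_addA.
Qed.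

Lemma K0addC : commutative K0add.
Proof. by move=> x y; apply/K0ofP; exact: eqv_addC. Qed.

Lemma K0add0 : left_id (K0of KZero) K0add.
Proof.
by move=> x; rewrite -(K0of_repr x) K0of_add; apply/K0ofP; exact: eqv_add0.
Qed.

Lemma K0addN : left_inverse (K0of KZero) K0opp K0add.
Proof.
move=> x; rewrite -(K0of_repr x) K0of_opp K0of_add.
by apply/K0ofP; exact: eqv_addN.
Qed.

Lemma K0mulA : associative K0mul.
Proof.
move=> x y z; rewrite -(K0of_repr x) -(K0of_repr y) -(K0of_repr z).
by rewrite !K0of_mul; apply/K0ofP; exact: eqv_mulA.
Qed.

Lemma K0mulC : commutative K0mul.
Proof. by move=> x y; apply/K0ofP; exact: eqv_mulC. Qed.

Lemma K0mul1 : left_id (K0of KOne) K0mul.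
Proof.
by move=> x; rewrite -(K0of_repr x) K0of_mul; apply/K0ofP; exact: eqv_mul1.
Qed.

Lemma K0mulD : left_distributive K0mul K0add.
Proof.
move=> x y z; rewrite -(K0of_repr x) -(K0of_repr y) -(K0of_repr z).
rewrite !(K0of_add, K0of_mul).
by apply/K0ofP; exact: eqv_mulD.
Qed.

HB.instance Definition _ :=
  GRing.isZmodule.Build K0 K0addA K0addC K0add0 K0addN.
HB.instance Definition _ :=
  GRing.Zmodule_isComPzRing.Build K0 K0mulA K0mulC K0mul1 K0mulD.

(* Only meaningful on locally closed sets. *)
Definition class n (X : set 'rV[C]_n) : K0 :=
  match pselect (locally_closed X) with
  | left hX => K0of (KClass (Variety hX))
  | right _ => 0
  end.

Definition lefschetz : K0 := class [set: 'rV[C]_1].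

(* The power L^k for an exponent k given as a difference of integers.  As L is
   not invertible in K_0(Var_C), a negative k has no meaning there; it gets the
   value 0.  The exponents C1 - C2 are fibre dimensions of the maps
   C^[D] -> C^[m(D)], hence nonnegative. *)
Definition lefschetz_pow (k : int) : K0 :=
  if k is Posz n then lefschetz ^+ n else 0.

(** * The varieties C^[D] and the Hilbert zeta function *)

(* Let M be the conductor of D.  An ideal I with v(I \ {0}) = D contains
   t^M C[[t]], so it is determined by its image modulo t^M, and hence by the
   matrix E whose row i, for i in D, is the unique element of that image of the
   form t^i + sum_(j notin D) E_ij t^j, and whose other rows are zero. *)
Definition reduced_basis (D : set nat) (I : set (series C)) n
    (E : 'M[C]_n) : Prop :=
  [/\ forall i j : 'I_n, ~ D i -> E i j = 0,
      forall i j : 'I_n, D i -> D j -> E i j = (i == j)%:R &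
      forall i : 'I_n, D i -> exists2 f, I f & forall j : 'I_n, f j = E i j].

(* C^[D], for the ring C[[t^g | g in G]].  It is Zariski closed when G \ D is
   finite: see [cell_closed]. *)
Definition cell (G D : set nat) :
    set 'rV[C]_(conductor D * conductor D) :=
  [set x | exists I, [/\ ideal (@semigroup_ring C G) I, values I = D &
                         reduced_basis D I (vec_mx x)]].
Arguments cell : clear implicits.

Definition poly_fun n (f : 'rV[C]_n -> C) : Prop :=
  exists p : {mpoly C[n]}, forall x : 'rV[C]_n, meval (fun i => x 0 i) p = f x.

Lemma poly_fun_ext n (f g : 'rV[C]_n -> C) : f =1 g -> poly_fun f -> poly_fun g.
Proof. by move=> fg [p fp]; exists p => x; rewrite fp. Qed.

Lemma poly_fun_cst n (c : C) : poly_fun (fun _ : 'rV[C]_n => c).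
Proof. by exists c%:MP_[n] => x; rewrite mevalC. Qed.

Lemma poly_fun_coord n i : poly_fun (fun x : 'rV[C]_n => x 0 i).
Proof. by exists 'X_i => x; rewrite mevalXU. Qed.

Lemma poly_funB n (f g : 'rV[C]_n -> C) :
  poly_fun f -> poly_fun g -> poly_fun (fun x => f x - g x).
Proof. by move=> [p fp] [q gq]; exists (p - q) => x; rewrite mevalB fp gq. Qed.

Lemma poly_funM n (f g : 'rV[C]_n -> C) :
  poly_fun f -> poly_fun g -> poly_fun (fun x => f x * g x).
Proof. by move=> [p fp] [q gq]; exists (p * q) => x; rewrite mevalM fp gq. Qed.

Lemma poly_fun_sum n (I : finType) (f : I -> 'rV[C]_n -> C) :
  (forall i, poly_fun (f i)) -> poly_fun (fun x => \sum_i f i x).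
Proof.
move=> /choice[p fp]; exists (\sum_i p i) => x.
by rewrite raddf_sum; apply: eq_bigr => i _; exact: fp.
Qed.

Definition zariski_closed n (X : set 'rV[C]_n) : Prop :=
  exists S, X = zeros S.

Lemma zariski_closed_locally n (X : set 'rV[C]_n) :
  zariski_closed X -> locally_closed X.
Proof.
move=> [S ->]; exists S, [:: 1]; apply/seteqP; split=> [x Sx|x []//].
split=> // /(_ 1); rewrite mem_head meval1 => /(_ isT)/eqP.
by rewrite oner_eq0.
Qed.

Lemma zariski_closed_eq n (f g : 'rV[C]_n -> C) :
  poly_fun f -> poly_fun g -> zariski_closed [set x | f x = g x].
Proof.
move=> pf pg; have [p fp] := poly_funB pf pg; exists [:: p].
apply/seteqP; split=> x /=.
  by move=> fg q; rewrite inE => /eqP ->; rewrite fp fg subrr.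
by move=> /(_ p); rewrite mem_head fp => /(_ isT)/eqP; rewrite subr_eq0 => /eqP.
Qed.

Lemma zariski_closedI n (X Y : set 'rV[C]_n) :
  zariski_closed X -> zariski_closed Y -> zariski_closed (X `&` Y).
Proof.
move=> [S ->] [T ->]; exists (S ++ T); apply/seteqP; split=> x.
  by move=> [Sx Tx] p; rewrite mem_cat => /orP[]; [exact: Sx|exact: Tx].
by move=> STx; split=> p pS; apply: STx; rewrite mem_cat pS ?orbT.
Qed.

Lemma zariski_closed_imply n (Q : Prop) (P : 'rV[C]_n -> Prop) :
  zariski_closed [set x | P x] -> zariski_closed [set x | Q -> P x].
Proof.
move=> [S PS]; case: (pselect Q) => [q|nq].
  by exists S; rewrite -PS; apply/seteqP; split=> x /=; [apply|move=> h _].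
by exists [::]; apply/seteqP; split=> x //=.
Qed.

Lemma zariski_closed_forall n (I : finType) (P : I -> 'rV[C]_n -> Prop) :
  (forall i, zariski_closed [set x | P i x]) ->
  zariski_closed [set x | forall i, P i x].
Proof.
move=> /choice[S PS]; exists (flatten [seq S i | i : I]).
apply/seteqP; split=> x /=.
  move=> Px p /flattenP[_ /mapP[i _ ->] pS].
  have h : [set y | P i y] x by exact: Px.
  by rewrite PS in h; exact: h.
move=> Sx i; suff : [set y | P i y] x by [].
rewrite PS => p pS; apply: Sx; apply/flattenP; exists (S i) => //.
by apply/mapP; exists i; rewrite ?mem_enum.
Qed.

Section CellClosed.
Context (G D : set nat).
Context (hG : numerical_semigroup G) (hD : subsemimodule G D).
Context (hfin : finite_set (~` D)).
Local Notation M := (conductor D).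
Local Notation A := (@semigroup_ring C G).

Lemma conductor_mem n : (M <= n)%N -> D n.
Proof.
have [c hc] : exists c, forall n, (c <= n)%N -> D n.
  have /finite_seqP[c hc] := hfin.
  exists (\max_(x <- c) x).+1 => m; rewrite ltnNge => hm.
  apply: contrapT => nDm; have : (m \in c) by have : (~` D) m by []; rewrite hc.
  by move=> mc; move/negP: hm; apply; apply: leq_bigmax_seq.
have ex : exists c, `[< forall n, (c <= n)%N -> D n >] by exists c; exact/asboolP.
rewrite /conductor; case: xgetP => [m _ [h _]|]; first exact: h.
case: (ex_minnP ex) => m /asboolP hm mmin /(_ m)[]; split=> // c' hc'.
by apply: mmin; exact/asboolP.
Qed.

(* Multiplication by t^a modulo t^M, acting on the right on row vectors. *)
Let S (a : nat) : 'M[C]_M := \matrix_(i, j) (j == (i + a)%N :> nat)%:R.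

Let trunc (f : series C) : 'rV[C]_M := \row_j f j.

Let smul_trunc (a f : series C) :
  trunc (smul a f) = \sum_(i < M) a i *: (trunc f *m S i).
Proof.
apply/rowP => l; rewrite !mxE summxE.
pose F i := \sum_(k < M) (k + i == l :> nat)%N%:R * f k.
transitivity (\sum_(i < M) a i * F i); last first.
  apply: eq_bigr => i _; rewrite !mxE; congr (_ * _); apply: eq_bigr => k _.
  by rewrite !mxE mulrC eq_sym.
rewrite /smul (big_ord_widen M (fun i => a i * f (l - i)%N)) //.
rewrite big_mkcond; apply: eq_bigr => i _; rewrite ltnS; case: leqP => il.
  have kM : (l - i < M)%N by rewrite (leq_ltn_trans (leq_subr _ _)).
  rewrite /F (bigD1 (Ordinal kM)) //= subnK// eqxx mul1r big1 ?addr0// => k kl.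
  case: eqP => [kil|_]; last by rewrite mul0r.
  by case/eqP: kl; apply: val_inj => /=; rewrite -kil addnK.
rewrite /F big1 ?mulr0// => k _; case: eqP; rewrite ?mul0r// => kil.
by move: il; rewrite -kil ltnNge leq_addl.
Qed.

Definition cell_equations (E : 'M[C]_M) : Prop :=
  [/\ forall i j : 'I_M, ~ D i -> E i j = 0,
      forall i j : 'I_M, D i -> D j -> E i j = (i == j)%:R,
      forall i j : 'I_M, (j < i)%N -> E i j = 0,
      forall i j : 'I_M, ~ G j -> E i j = 0 &
      forall a : 'I_M, G a -> E *m S a = E *m S a *m E].

Lemma ideal_equations (I : set (series C)) (E : 'M[C]_M) :
  ideal A I -> values I = D -> reduced_basis D I E -> cell_equations E.
Proof.
move=> [IA I0 ID IM] vI [E0 ED EI].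
have Ilow f (k : nat) : I f -> ~ D k -> f k <> 0 ->
    exists m, [/\ (m < k)%N, D m & f m <> 0].
  move=> If nDk fk.
  have ex : exists m, f m != 0 by exists k; exact/eqP.
  case: (ex_minnP ex) => m /eqP fm mmin.
  have Dm : D m.
    rewrite -vI; exists f => //; split=> // l lm; apply/eqP; apply: contraTT lm.
    by rewrite -leqNgt; exact: mmin.
  exists m; split=> //; have := mmin k; rewrite leq_eqVlt.
  by case/(_ _)/predU1P => [|mk|//]; [exact/eqP|subst m].
have fix_ f : I f -> trunc f = trunc f *m E.
  move=> If.
  have /choice[b hb] : forall i : 'I_M, exists g : series C,
      I g /\ (D i -> forall j : 'I_M, g j = E i j).
    move=> i; case: (pselect (D i)) => [/EI[g Ig gE]|nDi].
      by exists g; split.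
    by exists (fun=> 0); split.
  have Iscale a g : I g -> I (sscale a g).
    move=> Ig; have -> : sscale a g = smul (sscale a (sone C)) g.
      apply/funext => n; rewrite /smul big_ord_recl big1 ?addr0.
        by rewrite /sscale /sone eqxx mulr1 subn0.
      by move=> i _; rewrite /sscale /sone /= mulr0 mul0r.
    apply: IM => // n; rewrite /sscale /sone; case: eqP => [-> _|_].
      by case: hG.
    by rewrite mulr0.
  have Isum (s : seq 'I_M) (c : 'I_M -> C) :
      I (fun n => \sum_(i <- s) c i * b i n).
    elim: s => [|i s IHs].
      by rewrite (_ : (fun _ => _) = fun=> 0)//; apply/funext => n; rewrite big_nil.
    rewrite (_ : (fun _ => _) =
      sadd (sscale (c i) (b i)) (fun n => \sum_(i <- s) c i * b i n)); last first.
      by apply/funext => n; rewrite big_cons.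
    by apply: ID => //; apply: Iscale; exact: (hb i).1.
  pose c i := if `[< D i >] then - f i else 0.
  pose h := sadd f (fun n => \sum_(i : 'I_M) c i * b i n).
  have Ih : I h by exact: ID.
  have hE (j : 'I_M) : h j = f j - (trunc f *m E) 0 j.
    rewrite /h /sadd; congr (_ + _); rewrite mxE -sumrN; apply: eq_bigr => i _.
    rewrite /c mxE; case: asboolP => [Di|nDi].
      by rewrite ((hb i).2 Di) mulNr.
    by rewrite (E0 i j nDi) mulr0 mul0r oppr0.
  have hD0 (j : 'I_M) : D j -> h j = 0.
    move=> Dj; rewrite hE mxE (bigD1 j)//= mxE ED// eqxx mulr1.
    rewrite big1 ?addr0 ?subrr// => i ij; rewrite mxE.
    case: (pselect (D i)) => [Di|nDi]; last by rewrite E0// mulr0.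
    by rewrite ED// (negbTE ij) mulr0.
  apply/rowP => j; apply/eqP; rewrite mxE -subr_eq0 -hE; apply/eqP.
  apply: contrapT => hj.
  have nDj : ~ D j by move=> Dj; exact: hj (hD0 j Dj).
  have [m [mj Dm hm]] := Ilow _ _ Ih nDj hj.
  by apply: hm; exact: (hD0 (Ordinal (ltn_trans mj (ltn_ord j)))).
have rowE (i : 'I_M) (f : series C) : (forall j : 'I_M, f j = E i j) -> trunc f = row i E.
  by move=> fE; apply/rowP => j; rewrite !mxE.
split=> //.
- move=> i j ji; case: (pselect (D i)) => [Di|nDi]; last exact: E0.
  have [f If fE] := EI i Di.
  case: (pselect (D j)) => [Dj|nDj].
    by rewrite ED//; case: eqP ji => // ->; rewrite ltnn.
  apply: contrapT; rewrite -fE => fj.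
  have [m [mj Dm fm]] := Ilow _ _ If nDj fj.
  have mM := ltn_trans mj (ltn_ord j).
  apply: fm; rewrite (fE (Ordinal mM)) ED//; case: eqP => // im.
  by move: (ltn_trans mj ji); rewrite im ltnn.
- move=> i j nGj; case: (pselect (D i)) => [Di|nDi]; last exact: E0.
  have [f If fE] := EI i Di.
  by rewrite -fE; apply: contrapT => fj; exact: nGj (IA _ If _ fj).
- move=> a Ga; apply/row_matrixP => i; rewrite !row_mul.
  case: (pselect (D i)) => [Di|nDi]; last first.
    have -> : row i E = 0 by apply/rowP => j; rewrite !mxE E0.
    by rewrite !mul0mx.
  have [f If fE] := EI i Di; rewrite -(rowE _ _ fE).
  pose t : series C := fun n => (n == a :> nat)%:R.
  have It : I (smul t f).
    by apply: IM => // n; rewrite /t; case: eqP => [->|].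
  have := fix_ _ It; rewrite smul_trunc (bigD1 a)//= big1.
    by rewrite addr0 /t eqxx scale1r.
  by move=> k ka; rewrite /t (negbTE (_ : (k != a :> nat))) ?scale0r.
Qed.

Lemma equations_ideal (E : 'M[C]_M) : cell_equations E ->
  exists I, [/\ ideal A I, values I = D & reduced_basis D I E].
Proof.
move=> [E0 ED El EG ES].
pose I : set (series C) := [set f | A f /\ trunc f = trunc f *m E].
have [G0 GA _] := hG; have [DG _] := hD.
have Erow (i : 'I_M) : D i ->
    exists2 f, I f & forall j : 'I_M, f j = E i j.
  move=> Di; pose f n := if insub n is Some j then E i j else 0.
  have fE (j : 'I_M) : f j = E i j by rewrite /f valK.
  exists f => //; split.
    move=> n; rewrite /f; case: insubP => //= j _ <- Eij.
    by apply: contrapT => /EG.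
  have -> : trunc f = row i E by apply/rowP => j; rewrite !mxE.
  apply/rowP => j; rewrite mxE [RHS]mxE (bigD1 i)//= mxE (ED i i)// eqxx mul1r.
  rewrite big1 ?addr0// => k ki; rewrite mxE.
  case: (pselect (D k)) => [Dk|nDk]; last by rewrite (E0 k)// mulr0.
  by rewrite (ED i k)// eq_sym (negbTE ki) mul0r.
exists I; split => //.
- split.
  + by move=> f [].
  + split; first by move=> n.
    by rewrite (_ : trunc _ = 0) ?mul0mx//; apply/rowP => j; rewrite !mxE.
  + move=> f g [Af fE] [Ag gE]; split.
      move=> n fgn; apply: contrapT => nGn; apply: fgn; rewrite /sadd.
      have -> : f n = 0 by apply: contrapT => /Af.
      by rewrite add0r; apply: contrapT => /Ag.
    rewrite (_ : trunc _ = trunc f + trunc g); last first.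
      by apply/rowP => j; rewrite !mxE.
    by rewrite mulmxDl -fE -gE.
  + move=> a f Aa [Af fE]; split.
      move=> n afn; apply: contrapT => nGn; apply: afn; rewrite /smul.
      apply: big1 => i _; case: (pselect (G i)) => [Gi|nGi].
        case: (pselect (G (n - i)%N)) => [Gni|nGni].
          case: nGn; rewrite -(subnKC (_ : (i <= n)%N)) ?leq_ord//.
          exact: GA.
        have -> : f (n - i)%N = 0 by apply: contrapT => /Af.
        by rewrite mulr0.
      have -> : a i = 0 by apply: contrapT => /Aa.
      by rewrite mul0r.
    rewrite smul_trunc mulmx_suml; apply: eq_bigr => i _.
    rewrite -scalemxAl; case: (pselect (G i)) => [Gi|nGi].
      by rewrite {1}fE -mulmxA ES// !mulmxA -fE.
    have -> : a i = 0 by apply: contrapT => /Aa.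
    by rewrite !scale0r.
- apply/seteqP; split=> n.
    move=> [f [Af fE] [fn flow]]; case: (leqP M n) => [|nM].
      exact: conductor_mem.
    apply: contrapT => nDn; apply: fn.
    have := congr1 (fun v : 'rV_M => v 0 (Ordinal nM)) fE; rewrite !mxE /= => ->.
    apply: big1 => k _; rewrite mxE; case: (ltnP k n) => [kn|].
      by rewrite flow// mul0r.
    rewrite leq_eqVlt => /predU1P[nk|nk]; last by rewrite El// mulr0.
    by rewrite E0 ?mulr0// -nk.
  move=> Dn; case: (leqP M n) => [Mn|nM].
    exists (fun m => (m == n)%:R).
      split; first by move=> m; case: eqP => // -> _; exact: DG.
      rewrite (_ : trunc _ = 0) ?mul0mx//; apply/rowP => j; rewrite !mxE.
      by case: eqP (ltn_ord j) => // ->; rewrite ltnNge Mn.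
    by split=> [|m]; rewrite ?eqxx; [apply/eqP; exact: oner_neq0|case: ltngtP].
  have [f If fE] := Erow (Ordinal nM) Dn; exists f => //; split.
    by rewrite (fE (Ordinal nM)) ED// eqxx; apply/eqP; exact: oner_neq0.
  by move=> m mn; rewrite (fE (Ordinal (ltn_trans mn nM))) El.
Qed.

Lemma cell_closed : zariski_closed (cell G D).
Proof.
have -> : cell G D = [set x | cell_equations (vec_mx x)].
  apply/seteqP; split=> x; first by move=> [I [I1 I2 I3]]; exact: (ideal_equations I1 I2 I3).
  exact: equations_ideal.
have pE (i j : 'I_M) : poly_fun (fun x : 'rV[C]_(M * M) => vec_mx x i j).
  apply: (poly_fun_ext _ (poly_fun_coord (mxvec_index i j))) => x.
  by rewrite mxE.
have pES a (i j : 'I_M) :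
    poly_fun (fun x : 'rV[C]_(M * M) => (vec_mx x *m S a) i j).
  apply: (poly_fun_ext _ (poly_fun_sum (fun k =>
    poly_funM (pE i k) (poly_fun_cst _ (S a k j))))) => x.
  by rewrite [RHS]mxE.
have pESE a (i j : 'I_M) :
    poly_fun (fun x : 'rV[C]_(M * M) => (vec_mx x *m S a *m vec_mx x) i j).
  apply: (poly_fun_ext _ (poly_fun_sum (fun k =>
    poly_funM (pES a i k) (pE k j)))) => x.
  by rewrite [RHS]mxE.
rewrite (_ : [set x | _] =
  [set x | forall i j : 'I_M, ~ D i -> vec_mx x i j = 0] `&`
  [set x | forall i j : 'I_M, D i -> D j -> vec_mx x i j = (i == j)%:R] `&`
  [set x | forall i j : 'I_M, (j < i)%N -> vec_mx x i j = 0] `&`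
  [set x | forall i j : 'I_M, ~ G j -> vec_mx x i j = 0] `&`
  [set x | forall (a i j : 'I_M), G a ->
    (vec_mx x *m S a) i j = (vec_mx x *m S a *m vec_mx x) i j]).
  do 4?apply: zariski_closedI; do !apply: zariski_closed_forall => ?;
  do !apply: zariski_closed_imply; apply: zariski_closed_eq => //;
  exact: poly_fun_cst.
apply/seteqP; split=> x; first by
  move=> [h1 h2 h3 h4 h5]; do !split=> //; move=> a i j Ga; rewrite -h5.
move=> [[[[h1 h2] h3] h4] h5]; split=> // a Ga; apply/matrixP => i j.
exact: h5.
Qed.

End CellClosed.

Definition cell_class (G D : set nat) : K0 := class (cell G D).

(* Polynomials in q over K_0(Var_C) are given by their coefficients: the value
   at l is the coefficient of q^l. *)
Definition hilbert_zeta (G : set nat) : nat -> K0 := fun l =>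
  if l == 0%N then 1
  else if (l <= conductor G)%N then
    \sum_(D \in semimodules_of_colength G l) cell_class G D
  else 0.

Definition cell_recursion (G : set nat) : Prop :=
  cell_class G G = 1 /\
  forall D, subsemimodule G D -> D <> G -> finite_set (~` D) ->
    cell_class G D =
      cell_class G (fill G D) * lefschetz_pow ((C1 G D)%:Z - (C2 G D)%:Z).

(** * The algorithm *)

(* The input g is the increasing sequence of elements of the truncation of G;
   truncated semimodules are increasing subsequences of g. *)

Definition truncate (G : set nat) (n : nat) : seq nat :=
  [seq x <- iota 0 n.+1 | x \in G].

(* For increasing D the subtractions do not underflow. *)
Definition alg_mingens (g D : seq nat) : seq nat :=
  foldl (fun T a => if all (fun x => (a - x)%N \notin g) T
                    then rcons T a else T) [::] D.

Definition alg_syz (g D : seq nat) : seq nat :=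
  [seq a <- D |
    (2 <= count (fun x => (x <= a)%N && ((a - x)%N \in g))
                (alg_mingens g D))%N].

Definition alg_maxgap (g D : seq nat) : nat :=
  (\max_(x <- g | x \notin D) x)%N.

Definition alg_fill (g D : seq nat) : seq nat :=
  [seq x <- g | (x \in D) || (x == alg_maxgap g D)].

Definition alg_C1 (g D : seq nat) : nat :=
  count (fun x => (x < alg_maxgap g D)%N) (alg_mingens g D).

Definition alg_C2 (g D : seq nat) : nat :=
  count (fun x => (x < alg_maxgap g D)%N) (alg_mingens g (alg_syz g D)).

(* Colength l.+1. *)
Fixpoint alg_tree (g : seq nat) (l : nat) : seq (seq nat) :=
  if l is l'.+1 then
    undup [seq [seq x <- D | x != a] | D <- alg_tree g l', a <- alg_mingens g D]
  else [:: [seq x <- g | x != 0%N]].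

Fixpoint alg_class (g : seq nat) (l : nat) (D : seq nat) : K0 :=
  if l is l'.+1 then
    alg_class g l' (alg_fill g D)
      * lefschetz_pow ((alg_C1 g D)%:Z - (alg_C2 g D)%:Z)
  else 1.

Definition alg_output (g : seq nat) (c : nat) : nat -> K0 := fun l =>
  if l == 0%N then 1
  else if (l <= c)%N then \sum_(D <- alg_tree g l.-1) alg_class g l D
  else 0.

Definition works_correctly (G : set nat) (n : nat) : Prop :=
  alg_output (truncate G n) (conductor G) =1 hilbert_zeta G.

Definition minimal_effective_bound (G : set nat) (N : nat) : Prop :=
  works_correctly G N /\ forall n, works_correctly G n -> (N <= n)%N.

End Varieties.

(* Main.v *)
Require Import Defs.
From mathcomp Require Import all_boot all_algebra.
From mathcomp Require Import finmap.
From mathcomp Require Import boolp classical_sets functions cardinality fsbigop.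
From mathcomp Require Import reals complex zify.

Set Implicit Arguments.
Unset Strict Implicit.
Unset Printing Implicit Defensive.

Local Open Scope classical_set_scope.
Local Open Scope card_scope.
Local Open Scope nat_scope.

(** Fix n and truncate at n.  Whether an element x of a semimodule is a minimal
generator, or a syzygy, depends only on elements that are at most x; hence
each step of the algorithm on truncated data gives the truncation of its result
on full data ([alg_mingens_truncate], [alg_syz_truncate]).  The one place where
information above n could be lost is a gap of D, that is an element of G \ D:
as soon as no semimodule of colength at most c has a gap above n, the largest
gap, the semimodule m(D), the numbers C1 and C2 and the whole tree are computed
correctly.  The tree is then the list of the truncations of the semimodules of
the given colength, because removing a minimal generator is inverse to filling
the largest gap, and the recursion for the classes of the cells identifies the
output with the zeta function ([works_of_gap_le]).

It remains to bound the gaps ([gap_bound]).  The c + 1 elements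
0, c, ..., 2c - 1 of G cannot all be gaps of a semimodule D of colength at most
c, so D has an element d < 2c, and then it contains [d + c, oo): its gaps are at
most 3c - 2.  As G is not the set of all naturals, both c and the least generator
alpha_1 are at least 2, so 3c - 2 <= 4(c - 1) <= (c - 1)(alpha_1 + 2).  The
algorithm therefore works at this last value, and the least value at which it
works is no larger. *)

(** * Finite sets and truncations *)

Lemma memE T (A : set T) x : reflect (A x) (x \in A).
Proof. by apply: (iffP idP); [exact: set_mem|exact: mem_set]. Qed.

Lemma card_eq_IP (T : choiceType) (A : set T) n :
  (A #= `I_n) <-> finite_set A /\ #|` fset_set A|%fset = n.
Proof.
split=> [An|[finA <-]]; last first.
  by rewrite -{1}(fset_setK finA); apply/card_eq_fsetP.
by split; [apply/finite_setP; exists n|exact: card_fset_set].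
Qed.

Lemma card_eq_setU1 (T : choiceType) (A : set T) a n : ~ A a ->
  (a |` A #= `I_n.+1) <-> (A #= `I_n).
Proof.
move=> nAa; rewrite !card_eq_IP finite_setU.
have cE : finite_set A -> #|` fset_set (a |` A)|%fset = (#|` fset_set A|%fset).+1.
  move=> fA; rewrite fset_setU1// cardfsU1 in_fset_set//.
  by case: (memE A a).
split=> [[[_ fA]]|[fA An]]; first by rewrite cE// => -[].
by rewrite cE// An; split.
Qed.

Lemma count_ge2P (T : eqType) (p : pred T) (s : seq T) : uniq s ->
  reflect (exists x y, [/\ x \in s, y \in s, x != y, p x & p y])
          (2 <= count p s).
Proof.
move=> us; apply: (iffP idP) => [|[x [y [xs ys xy px py]]]].
  have mf x : x \in filter p s -> x \in s /\ p x.
    by rewrite mem_filter => /andP[].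
  rewrite -size_filter; have := filter_uniq p us.
  case: (filter p s) mf => [|x [|y s']]//= mf /andP[xN _] _.
  have [xs px] : x \in s /\ p x by apply: mf; rewrite mem_head.
  have [ys py] : y \in s /\ p y by apply: mf; rewrite !inE eqxx orbT.
  by exists x, y; split=> //; move: xN; rewrite inE negb_or => /andP[].
rewrite -size_filter; apply: (@uniq_leq_size _ [:: x; y]); first by rewrite /= inE xy.
by move=> z; rewrite !inE mem_filter => /orP[]/eqP ->; rewrite ?px ?py.
Qed.

Lemma mem_truncate (G : set nat) n x : (x \in truncate G n) = (x <= n) && (x \in G).
Proof. by rewrite mem_filter mem_iota andbC. Qed.

Lemma truncate_uniq G n : uniq (truncate G n).
Proof. by rewrite filter_uniq// iota_uniq. Qed.

(** All lists that the algorithm filters out of a truncation are recognized as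
truncations through this lemma. *)
Lemma filter_truncate (G G' : set nat) (p : pred nat) n :
  (forall x, x <= n -> G' x <-> G x /\ p x) ->
  [seq x <- truncate G n | p x] = truncate G' n.
Proof.
move=> GG'; rewrite /truncate -filter_predI.
apply: eq_in_filter => x; rewrite mem_iota => /= xn.
apply/andP/memE => [[px /memE Gx]|/(GG' _ xn)[Gx px]]; first exact/(GG' _ xn).
by split=> //; exact/memE.
Qed.

(** The counts C1 and C2 only see elements below the largest gap, so they survive
truncation at any n above that gap. *)
Lemma count_truncate T n g : g <= n ->
  count (fun x => x < g) (truncate T n) = count_below T g.
Proof.
move=> gn; rewrite count_filter /count_below -sum1_card.
have -> : n.+1 = g + (n.+1 - g) by lia.
rewrite iotaD count_cat [X in _ + X](_ : _ = 0) ?addn0; last first.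
  apply/eqP; rewrite -leqn0 leqNgt -has_count; apply/hasP => -[x].
  by rewrite mem_iota /= => xg /andP[]; lia.
rewrite -(big_mkord (fun i => i \in T) (fun=> 1)) sum1_count /index_iota subn0.
apply: eq_in_count => x; rewrite mem_iota /= => xg.
by rewrite (_ : x < g)//; lia.
Qed.

(** * Minimal generators and syzygies *)

Section Semigroup.
Context (G : set nat) (hG : numerical_semigroup G).

Let G0 : G 0. Proof. by case: hG. Qed.
Let GD a b : G a -> G b -> G (a + b). Proof. by case: hG => _ + _; apply. Qed.

(** A minimal generator g lies in every generating set.  If g - d were in G for a
smaller d of D, then D without g would still generate D; conversely, when no
such d exists, g can only be written as g + 0. *)
Lemma mingensP D g : semimodule G D ->
  mingens G D g <-> D g /\ forall d, D d -> d < g -> ~ G (g - d).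
Proof.
move=> sD; split=> [Tg|[Dg gmin] T TD].
  have Dg : D g.
    apply: Tg; apply/seteqP; split=> [_ [t [b [Dt Gb ->]]]|d Dd]; first exact: sD.
    by exists d, 0; rewrite addn0.
  split=> // d Dd dg Ggd.
  suff : (D `\ g) g by case=> _ /(_ erefl).
  apply: Tg; apply/seteqP; split=> [_ [t [b [[Dt _] Gb ->]]]|e De]; first exact: sD.
  have [->|eg] := eqVneq e g.
    exists d, (g - d); split=> //; last by lia.
    by split=> //= dg'; lia.
  by exists e, 0; rewrite addn0; split=> //; split=> //=; exact/eqP.
have [t [b [Tt Gb gtb]]] : semimodule_span G T g by rewrite TD.
have Dt : D t by rewrite -TD; exists t, 0; rewrite addn0.
case: b Gb gtb => [|b] Gb gtb; first by rewrite gtb addn0.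
by case: (gmin t) => //; [lia|rewrite gtb addKn].
Qed.

(** Descending from d by elements of G inside D ends at a minimal generator. *)
Lemma mingens_below D d : semimodule G D -> D d ->
  exists2 x, mingens G D x & x <= d /\ G (d - x).
Proof.
move=> sD; elim/ltn_ind: d => d IH Dd.
have [mx|nmx] := pselect (mingens G D d).
  by exists d => //; rewrite subnn.
have [e [De ed Gde]] : exists e, [/\ D e, e < d & G (d - e)].
  apply: contrapT => H; apply: nmx; apply/mingensP => //; split=> // e De ed Ge.
  by apply: H; exists e.
have [x mx [xe Gex]] := IH e ed De.
exists x => //; split; first by lia.
by rewrite (_ : d - x = (d - e) + (e - x)); [exact: GD|lia].
Qed.

(** The greedy scan tests a new element only against the generators found so far,
which suffices by [mingens_below]: an element reachable from a smaller element
of D is reachable from a smaller minimal generator. *)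
Lemma alg_mingens_truncate D n : semimodule G D ->
  alg_mingens (truncate G n) (truncate D n) = truncate (mingens G D) n.
Proof.
move=> sD; rewrite /truncate.
(* The truncation of D is cut at m while that of G stays at n, so that all the
   differences m - x are visible to the scan. *)
suff H m : m <= n.+1 -> alg_mingens (truncate G n) [seq x <- iota 0 m | x \in D] =
    [seq x <- iota 0 m | x \in mingens G D] by exact: H.
elim: m => [|m IH] mn //; rewrite -addn1 iotaD !filter_cat /= add0n.
rewrite /alg_mingens foldl_cat -/(alg_mingens _ _) IH; last by lia.
case: (memE D m) => [Dm|nDm] /=; last first.
  case: memE => [/mingensP[]//|_]; by rewrite cats0.
rewrite (_ : all _ _ = (m \in mingens G D)).
  by case: (m \in _); rewrite ?cats1 ?cats0.
apply/allP/memE => [H|/mingensP[]// _ H x].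
  have [x mx [xm Gmx]] := mingens_below sD Dm.
  have [xm'|xm'] := eqVneq x m; first by rewrite -xm'.
  have := H x; rewrite mem_filter mem_iota mem_truncate.
  have -> : x \in mingens G D by exact/memE.
  have -> : m - x \in G by exact/memE.
  by move=> /(_ _)/negP[]; lia.
rewrite mem_filter mem_iota mem_truncate => /andP[/memE/mingensP[]// Dx _ xm].
by apply/negP => /andP[_ /memE]; apply: H.
Qed.

Lemma syz_semimodule D : semimodule G D -> semimodule G (syz G D).
Proof.
move=> sD s b [Ds [g1 [g2 [b1 [b2 [[m1 m2 g12 G1 G2] [s1 s2]]]]]]] Gb.
split; first exact: sD.
exists g1, g2, (b1 + b), (b2 + b); split; first by split=> //; exact: GD.
by split; [rewrite s1|rewrite s2]; lia.
Qed.

Lemma alg_syz_truncate D n : semimodule G D ->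
  alg_syz (truncate G n) (truncate D n) = truncate (syz G D) n.
Proof.
move=> sD; rewrite /alg_syz alg_mingens_truncate//.
apply: filter_truncate => s sn; split.
  move=> [Ds [g1 [g2 [b1 [b2 [[m1 m2 g12 G1 G2] [s1 s2]]]]]]]; split=> //.
  apply/count_ge2P; first exact: truncate_uniq.
  exists g1, g2; rewrite !mem_truncate; split; last 3 [exact/eqP].
  - by apply/andP; split; [lia|exact/memE].
  - by apply/andP; split; [lia|exact/memE].
  - apply/and3P; split; [lia|lia|]; apply/memE.
    by rewrite s1 addKn.
  - apply/and3P; split; [lia|lia|]; apply/memE.
    by rewrite s2 addKn.
move=> [Ds /(count_ge2P _ (truncate_uniq _ _))[x [y []]]]; rewrite !mem_truncate.
move=> /andP[_ /memE mx] /andP[_ /memE my] /eqP xy.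
move=> /and3P[xs _ /memE Gx] /and3P[ys _ /memE Gy].
split=> //; exists x, y, (s - x), (s - y).
by split=> //; lia.
Qed.

End Semigroup.

(** * Removing generators, filling gaps *)

Section Gaps.
Context (G : set nat) (hG : numerical_semigroup G).

Let G0 : G 0. Proof. by case: hG. Qed.
Let GD a b : G a -> G b -> G (a + b). Proof. by case: hG => _ + _; apply. Qed.

Lemma semimodules_of_colength0 D :
  semimodules_of_colength G 0 D <-> D = G.
Proof.
split=> [[[DG _]]|->]; rewrite /semimodules_of_colength /= II0 card_eq0.
  by move=> /eqP GD0; apply/seteqP; split=> // x Gx; apply: contrapT => nDx;
     have : (G `\` D) x by []; rewrite GD0.
by split; [split|rewrite setDv].
Qed.

(** A bound n on the gaps makes the maximum in [maxgap] exist. *)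
Lemma maxgapP (D : set nat) n : (exists x, G x /\ ~ D x) ->
    (forall x, G x -> ~ D x -> x <= n) ->
  [/\ G (maxgap G D), ~ D (maxgap G D) &
      forall x, G x -> ~ D x -> x <= maxgap G D].
Proof.
move=> [x [Gx nDx]] bnd.
have exP : exists x, (x \in G) && (x \notin D).
  by exists x; apply/andP; split; [exact/memE|apply/memE].
have bP y : (y \in G) && (y \notin D) -> y <= n.
  by move=> /andP[/memE Gy /memE nDy]; exact: bnd.
rewrite /maxgap; case: xgetP => [m _ [[Gm nDm] mmax]|].
  by split=> // y Gy nDy; exact: mmax.
case: (ex_maxnP exP bP) => m /andP[/memE Gm /memE nDm] mmax /(_ m)[].
by split=> // y [Gy nDy]; apply: mmax; apply/andP; split; [exact/memE|apply/memE].
Qed.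

(** The downward edges of the tree of semimodules. *)
Lemma remove_mingen D a l : semimodules_of_colength G l D -> mingens G D a ->
  semimodules_of_colength G l.+1 (D `\ a).
Proof.
move=> [[DG sD] cD] /mingensP[]// Da amin; split; first split.
- by move=> x [/DG].
- move=> d g [Dd da] Gg; split; first exact: sD.
  move=> /= dga; case: g Gg dga => [|g] Gg dga.
    by apply: da; rewrite /= -dga addn0.
  apply: (amin d) => //; first by lia.
  by rewrite (_ : a - d = g.+1); [|lia].
rewrite (_ : G `\` (D `\ a) = a |` (G `\` D)); first by apply/card_eq_setU1 => // -[].
apply/seteqP; split=> x.
  move=> [Gx nDax]; have [->|xa] := eqVneq x a; first by left.
  by right; split=> // Dx; apply: nDax; split=> //=; exact/eqP.
move=> [->|[Gx nDx]]; split=> //; first exact: DG.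
  by move=> [_ /(_ erefl)].
by move=> [].
Qed.

(** The upward edges: adding the largest gap gives a semimodule because every sum
of it with a nonzero element of G exceeds all gaps, and it is a minimal
generator of the result because D is closed under G. *)
Lemma fillP (D : set nat) n l : (forall x, G x -> ~ D x -> x <= n) ->
    semimodules_of_colength G l.+1 D ->
  [/\ semimodules_of_colength G l (fill G D), mingens G (fill G D) (maxgap G D),
      G (maxgap G D), ~ D (maxgap G D) &
      forall x, G x -> ~ D x -> x <= maxgap G D].
Proof.
move=> bnd [[DG sD] cD].
have [Gm nDm mmax] : [/\ G (maxgap G D), ~ D (maxgap G D) &
      forall x, G x -> ~ D x -> x <= maxgap G D].
  apply: maxgapP bnd; apply: contrapT => H.
  have /semimodules_of_colength0 DE : D = G.
    apply/seteqP; split=> // x Gx; apply: contrapT => nDx.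
    by apply: H; exists x.
  have [_] := DE; rewrite card_eq_sym => /card_eq_trans /(_ cD).
  by move/card_eq_II.
have sF : semimodule G (fill G D).
  move=> d g [Dd|/= ->] Gg; first by left; exact: sD.
  have [Dg|nDg] := pselect (D (maxgap G D + g)); first by left.
  right => /=; have := mmax _ (GD Gm Gg) nDg; lia.
split=> //.
  split; first by split=> // x [/DG//|/= ->].
  apply/(@card_eq_setU1 _ _ (maxgap G D)); first by case=> _; apply; right.
  rewrite (_ : _ |` _ = G `\` D)//; apply/seteqP; split=> x.
    by move=> [/= ->|[Gx nFx]]; split=> // Dx; apply: nFx; left.
  move=> [Gx nDx]; have [->|xm] := eqVneq x (maxgap G D); first by left.
  by right; split=> // -[//|/eqP]; rewrite (negbTE xm).
apply/mingensP => //; split; first by right.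
move=> d [Dd|/= ->] dm Gmd; last by lia.
by apply: nDm; rewrite (_ : maxgap G D = d + (maxgap G D - d)); [exact: sD|lia].
Qed.

Lemma fillD1 (D : set nat) : D `<=` G -> ~ D (maxgap G D) -> fill G D `\ maxgap G D = D.
Proof.
move=> DG nDm; apply/seteqP; split=> x; first by move=> [[//|->] /(_ erefl)].
by move=> Dx; split; [left|move=> /= xm; apply: nDm; rewrite -xm].
Qed.

Lemma conductor_ge n : conductor G <= n -> G n.
Proof. by apply: conductor_mem; case: hG. Qed.

(** Among 0 and c, ..., 2c - 1, all in G, at least one is in D, since at most c
elements of G are missing from D; beyond it by c, everything is in D. *)
Lemma gap_bound (D : set nat) l x : 0 < conductor G -> l <= conductor G ->
  semimodules_of_colength G l D -> G x -> ~ D x -> x.+2 <= 3 * conductor G.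
Proof.
set c := conductor G => c0 lc [[DG sD] cD] Gx nDx.
have [d Dd dc] : exists2 d, D d & d < 2 * c.
  apply: contrapT => H; have [fin cE] := (card_eq_IP _ _).1 cD.
  suff : c.+1 <= l by lia.
  rewrite -cE -(size_iota c c) -/(size (0 :: iota c c)).
  apply: uniq_leq_size; first by rewrite /= mem_iota iota_uniq; lia.
  move=> y ys; rewrite in_fset_set//; apply/memE.
  have yc : y < 2 * c by move: ys; rewrite inE mem_iota; lia.
  split; last by move=> Dy; apply: H; exists y.
  move: ys; rewrite inE mem_iota => /orP[/eqP ->//|yc'].
  by apply: conductor_ge; rewrite -/c; lia.
rewrite ltnNge; apply/negP => xc; apply: nDx.
rewrite (_ : x = d + (x - d)); last by lia.
by apply: sD => //; apply: conductor_ge; rewrite -/c; lia.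
Qed.

End Gaps.

(** * Correctness of the truncated algorithm *)

Section Works.
Context (R : realType) (G : set nat) (hG : numerical_semigroup G).
Context (hcell : cell_recursion R G) (n : nat).
Hypothesis gap_le : forall l (D : set nat) x, l <= conductor G ->
  semimodules_of_colength G l D -> G x -> ~ D x -> x <= n.
Local Notation g := (truncate G n).

Lemma alg_maxgap_truncate l D : l < conductor G ->
  semimodules_of_colength G l.+1 D ->
  alg_maxgap g (truncate D n) = maxgap G D.
Proof.
move=> lc hD; have bnd x : G x -> ~ D x -> x <= n by exact: gap_le hD.
have [_ _ Gm nDm mmax] := fillP hG bnd hD.
have mn := bnd _ Gm nDm; apply/eqP; rewrite eqn_leq; apply/andP; split.
  apply/bigmax_leqP_seq => x; rewrite !mem_truncate => /andP[xn /memE Gx].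
  by rewrite xn /= => /memE nDx; exact: mmax.
apply: (@leq_bigmax_seq _ _ _ (fun x => x)); rewrite mem_truncate mn.
  exact/memE.
by apply/memE.
Qed.

Lemma alg_fill_truncate l D : l < conductor G ->
  semimodules_of_colength G l.+1 D ->
  alg_fill g (truncate D n) = truncate (fill G D) n.
Proof.
move=> lc hD; rewrite /alg_fill (alg_maxgap_truncate lc hD).
have bnd x : G x -> ~ D x -> x <= n by exact: gap_le hD.
have [_ _ Gm nDm _] := fillP hG bnd hD; have [[DG _] _] := hD.
apply: filter_truncate => x xn; rewrite mem_truncate xn /=; split.
  by move=> [Dx|/= ->]; [split; [exact: DG|apply/orP; left; exact/memE]|rewrite eqxx orbT].
by move=> [_ /orP[/memE|/eqP]]; [left|right].
Qed.

Lemma alg_C1_truncate l D : l < conductor G ->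
  semimodules_of_colength G l.+1 D -> alg_C1 g (truncate D n) = C1 G D.
Proof.
move=> lc hD; have bnd x : G x -> ~ D x -> x <= n by exact: gap_le hD.
have [_ _ Gm nDm _] := fillP hG bnd hD; have [[_ sD] _] := hD.
rewrite /alg_C1 (alg_maxgap_truncate lc hD) alg_mingens_truncate//.
by rewrite count_truncate//; exact: bnd.
Qed.

Lemma alg_C2_truncate l D : l < conductor G ->
  semimodules_of_colength G l.+1 D -> alg_C2 g (truncate D n) = C2 G D.
Proof.
move=> lc hD; have bnd x : G x -> ~ D x -> x <= n by exact: gap_le hD.
have [_ _ Gm nDm _] := fillP hG bnd hD; have [[_ sD] _] := hD.
rewrite /alg_C2 (alg_maxgap_truncate lc hD) alg_syz_truncate//.
rewrite alg_mingens_truncate//; last exact: syz_semimodule.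
by rewrite count_truncate//; exact: bnd.
Qed.

(** The recursion of the algorithm is the one that the classes of the cells
satisfy, with D and m(D) read off their truncations. *)
Lemma alg_class_truncate l D : l <= conductor G ->
  semimodules_of_colength G l D ->
  alg_class R g l (truncate D n) = cell_class R G D.
Proof.
elim: l D => [|l IH] D lc hD /=.
  by move/(semimodules_of_colength0 hG): hD => ->; case: hcell => ->.
have bnd x : G x -> ~ D x -> x <= n by exact: gap_le hD.
have [hF _ Gm nDm _] := fillP hG bnd hD; have [sD cD] := hD.
have [_ rec] := hcell; rewrite rec//; last first.
- have -> : ~` D = (~` G) `|` (G `\` D).
    apply/seteqP; split=> x /= => [nDx|[nGx|[]//]]; last by move=> /sD.1.
    by have [Gx|nGx] := pselect (G x); [right|left].
  rewrite finite_setU; split; first by case: hG.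
  by apply/finite_setP; exists l.+1.
- by move=> DG; apply: nDm; move: (maxgap G D) Gm => m; rewrite DG.
rewrite (alg_fill_truncate lc hD) IH//; last exact: ltnW.
by rewrite (alg_C1_truncate lc hD) (alg_C2_truncate lc hD).
Qed.

Lemma truncateD1 (D : set nat) a :
  [seq x <- truncate D n | x != a] = truncate (D `\ a) n.
Proof.
apply: filter_truncate => x _; split=> -[Dx /= xa]; split=> //; exact/eqP.
Qed.

(** A proper semimodule D is m(D) minus one of the minimal generators of m(D), so
removing generators in all possible ways reaches all of them. *)
Lemma alg_treeP l s : l < conductor G ->
  s \in alg_tree g l <->
  exists2 D, semimodules_of_colength G l.+1 D & s = truncate D n.
Proof.
elim: l s => [|l IH] s lc /=.
  rewrite truncateD1 inE.
  have GG : semimodules_of_colength G 0 G by exact/(semimodules_of_colength0 hG).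
  have hG0 : semimodules_of_colength G 1 (G `\ 0).
    apply: remove_mingen => //; apply/mingensP => //; first by case: GG => -[].
    by split=> //; case: hG.
  split=> [/eqP ->|[D hD ->]]; first by exists (G `\ 0).
  have bnd x : G x -> ~ D x -> x <= n by exact: gap_le hD.
  have [/(semimodules_of_colength0 hG) FE mF Gm nDm _] := fillP hG bnd hD.
  have [[_ sG] _] := GG.
  move: mF; rewrite FE => /(mingensP hG _ sG)[_ mmin].
  (* m(D) = G, whose only minimal generator is 0. *)
  have -> : G `\ 0 = D; last by [].
  rewrite -(fillD1 hD.1.1 nDm) FE; case: (maxgap G D) mmin Gm => [//|m] mmin Gm.
  by case: (mmin 0); rewrite ?subn0//; case: hG.
rewrite mem_undup; split=> [/allpairsPdep[t [a [tl ta ->]]]|[D hD ->]].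
  move/IH: tl => [|D hD tE]; first exact: ltnW.
  subst t; move: ta; have [[_ sD] _] := hD.
  rewrite alg_mingens_truncate// mem_truncate => /andP[_ /memE aD].
  exists (D `\ a); last exact: truncateD1.
  exact: remove_mingen.
have bnd x : G x -> ~ D x -> x <= n by exact: gap_le hD.
have [hF mF Gm nDm _] := fillP hG bnd hD; have [[DG sD] _] := hD.
apply/allpairsPdep; exists (truncate (fill G D) n), (maxgap G D); split.
- by apply/IH; [exact: ltnW|exists (fill G D)].
- have [[_ sF] _] := hF; rewrite alg_mingens_truncate// mem_truncate.
  by rewrite bnd//; exact/memE.
by rewrite truncateD1 fillD1.
Qed.

Lemma alg_tree_uniq l : uniq (alg_tree g l).
Proof. by case: l => [|l] //=; exact: undup_uniq. Qed.

(** Two semimodules without gaps above n agree above n, so a truncation at n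
determines the semimodule and the sum over the tree has no repetitions. *)
Lemma truncate_bij l : l < conductor G ->
  set_bij (semimodules_of_colength G l.+1) [set` alg_tree g l]
          (fun D => truncate D n).
Proof.
move=> lc; split=> [D hD|D D' /memE hD /memE hD' DD'|s /alg_treeP[]//D hD ->].
- by apply/alg_treeP => //; exists D.
- have sub E E' : semimodules_of_colength G l.+1 E ->
      semimodules_of_colength G l.+1 E' -> truncate E n = truncate E' n -> E `<=` E'.
    move=> hE hE' EE' x Ex; apply: contrapT => nEx.
    have xn : x <= n by apply: gap_le hE' _ _ => //; case: hE => -[EG _] _; exact: EG.
    have := mem_truncate E' n x; rewrite -EE' mem_truncate xn /=.
    by case: memE => // _; case: memE.
  by apply/seteqP; split; apply: sub.
- by exists D.
Qed.

Lemma works_of_gap_le : works_correctly R G n.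
Proof.
move=> l; rewrite /alg_output /hilbert_zeta; case: l => [//|l] /=.
case: ifP => // lc; rewrite fsbig_seq ?alg_tree_uniq//.
rewrite (reindex_fsbig _ _ _ _ (truncate_bij lc)); apply: eq_fsbigr => D /memE hD.
exact: (alg_class_truncate (l := l.+1)).
Qed.

End Works.

(** * The bound *)

Lemma conductor_ge2 G : numerical_semigroup G -> G <> setT -> 1 < conductor G.
Proof.
move=> hG GT; rewrite ltnNge; apply/negP => c1; apply: GT.
apply/seteqP; split=> // -[|x] _; first by case: hG.
by apply: (conductor_ge hG); lia.
Qed.

Lemma generated_mul s a k : uniq s -> a \in s -> generated s (k * a).
Proof.
move=> us sa; exists (fun b => (b == a) * k).
by rewrite (bigD1_seq a)//= eqxx mul1n big1 ?addn0// => b /negbTE ->.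
Qed.

(** The least generator is not 0, which could be dropped from the generators, and
not 1, which generates everything. *)
Lemma minimal_generators_head_ge2 G s : numerical_semigroup G -> G <> setT ->
  minimal_generators G s -> 1 < nth 0 s 0.
Proof.
move=> hG GT [ss sG smin].
have us : uniq s by apply: sorted_uniq ss; [exact: ltn_trans|exact: ltnn].
have c1 := conductor_ge2 hG GT.
case: s => [|[|[|a]] s] // in ss sG smin us *.
- have : G (conductor G) by exact: conductor_ge.
  by rewrite -{1}sG => -[k]; rewrite big_nil; lia.
- have : 0 \in s; last by move: us => /= /andP[/negbTE ->].
  apply: (smin s); last exact: mem_head.
    by move=> x xs; rewrite inE xs orbT.
  rewrite -sG; apply/seteqP; split=> x [k ->]; exists k.
    by rewrite big_cons muln0.
  by rewrite big_cons muln0.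
- case: GT; rewrite -sG; apply/seteqP; split=> // x _.
  by rewrite -(muln1 x); apply: generated_mul => //; exact: mem_head.
Qed.

Theorem theorem7p3 (R : realType) (G : set nat) (alpha : seq nat)
    (hG : numerical_semigroup G) (hGN : G <> setT)
    (halpha : minimal_generators G alpha)
    (hform : monomial_semigroup (R[i])%C G \/
             (size alpha = 2 /\ coprime (nth 0 alpha 0) (nth 0 alpha 1)))
    (hcell : cell_recursion R G) :
  exists N, minimal_effective_bound R G N /\
            N <= (conductor G - 1) * (nth 0 alpha 0 + 2).
Proof.
have c2 := conductor_ge2 hG hGN.
have a2 := minimal_generators_head_ge2 hG hGN halpha.
set B := (_ * _).
have B4 : 4 * (conductor G - 1) <= B by rewrite mulnC leq_mul2l; lia.
have wB : works_correctly R G B.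
  apply: works_of_gap_le => // l D x lc hD Gx nDx.
  have := gap_bound hG _ lc hD Gx nDx; lia.
have ex : exists n, `[< works_correctly R G n >] by exists B; exact/asboolP.
case: (ex_minnP ex) => N /asboolP wN Nmin; exists N; split.
  by split=> // n wn; apply: Nmin; exact/asboolP.
by apply: Nmin; exact/asboolP.
Qed.
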